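(* Let $n\ge1$ and let $T$ be a noncrossing tree on the vertex set $[n+1]$. Let $T_1,\ldots,T_k$ be the noncrossing alternating spanning trees of $\overline{T}$, indexed so that $\mathcal{P}(T_1)<_{lex}\cdots<_{lex}\mathcal{P}(T_k)$. Then $\mathcal{P}(T_1),\ldots,\mathcal{P}(T_k)$ is a shelling order (of the triangulation of $\mathcal{P}(T)$ with maximal simplices $\mathcal{P}(T_1),\ldots,\mathcal{P}(T_k)$).
   Context: Graphs have vertex set $[n+1]=\{1,\ldots,n+1\}$; an edge joining $i<j$ is written $(i,j)$. A graph is noncrossing if there are no $i<j<k<l$ with $(i,k),(j,l)$ both edges; alternating if there are no $i<j<k$ with $(i,j),(j,k)$ both edges. The transitive closure $\overline{G}$ has as edges all $(i,j)$ for which there are edges $(i,i_1),(i_1,i_2),\ldots,(i_r,j)$ of $G$ with $i<i_1<\cdots<i_r<j$ (edges of $G$ included). A spanning tree of $\overline{T}$ is a tree with vertex set $[n+1]$ with all edges in $\overline{T}$. Let $e_1,\ldots,e_{n+1}$ be the coordinate vectors of $\mathbb{R}^{n+1}$. $\mathcal{P}(A_n^+)$ is the convex hull of the origin and the points $e_i-e_j$, $1\le i<j\le n+1$; $\mathcal{C}(G)$ is the cone of nonnegative combinations of the $e_i-e_j$ with $(i,j)\in E(G)$, $i<j$; and $\mathcal{P}(G)=\mathcal{P}(A_n^+)\cap\mathcal{C}(G)$. The polytopes $\mathcal{P}(T_1),\ldots,\mathcal{P}(T_k)$ are $n$-dimensional simplices that, together with their faces, triangulate $\mathcal{P}(T)$.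 Order on edges (conventional lexicographic): $(i_1,j_1)$ is less than $(i_2,j_2)$ if $i_1<i_2$, or $i_1=i_2$ and $j_1<j_2$. Order on simplices: $\mathcal{P}(T_i)<_{lex}\mathcal{P}(T_j)$ if and only if for some $l$ the first $l$ edges of $T_i$ and $T_j$ in the lexicographic ordering coincide and the $(l+1)$st edge of $T_i$ is less than the $(l+1)$st edge of $T_j$. A linear order $F_1,\ldots,F_k$ of the maximal simplices is a shelling if for all $2\le i\le k$, $F_i$ is attached to $F_1\cup\cdots\cup F_{i-1}$ on a union of nonzero facets of $F_i$, i.e. $F_i\cap(F_1\cup\cdots\cup F_{i-1})$ is a union of a nonzero number of facets of $F_i$. *)

(* Defs.v *)
From mathcomp Require Import all_boot all_order all_algebra.
From mathcomp Require Import classical_sets reals.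

Set Implicit Arguments.
Unset Strict Implicit.
Unset Printing Implicit Defensive.

Import Order.TTheory GRing.Theory Num.Theory.

(* The vertex set [n+1] = {1, ..., n+1} is rendered as 'I_n.+1 = {0, ..., n};
   the shift by one is immaterial.  An edge joining i < j is the pair (i, j),
   so a graph is a set of pairs satisfying [is_graph]. *)
Definition edge (n : nat) : finType := ('I_n.+1 * 'I_n.+1)%type.
Definition graph (n : nat) : finType := {set edge n}.

Section Graphs.
Variable n : nat.
Implicit Types (G S T : graph n) (e f : edge n).

Definition is_graph G : Prop := forall e, e \in G -> e.1 < e.2.

Definition adj G : rel 'I_n.+1 :=
  fun x y => ((x, y) \in G) || ((y, x) \in G).

Definition graph_connected G : Prop :=
  forall x y : 'I_n.+1, connect (adj G) x y.

(* A cycle has at least three, pairwise distinct, vertices. *)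
Definition graph_acyclic G : Prop :=
  forall c : seq 'I_n.+1, 2 < size c -> ~ ucycle (adj G) c.

Definition is_tree G : Prop :=
  [/\ is_graph G, graph_connected G & graph_acyclic G].

Definition noncrossing G : Prop :=
  forall i j k l : 'I_n.+1, i < j -> j < k -> k < l ->
    ~ ((i, k) \in G /\ (j, l) \in G).

Definition alternating G : Prop :=
  forall i j k : 'I_n.+1, i < j -> j < k ->
    ~ ((i, j) \in G /\ (j, k) \in G).

(* The edges of G are directed upwards, so a directed path from i to j != i is
   automatically an increasing one. *)
Definition tclosure G : graph n :=
  [set e : edge n |
    (e.1 < e.2) && connect (fun x y => (x, y) \in G) e.1 e.2].

Definition spanning_tree_of G S : Prop := is_tree S /\ S \subset G.

Definition edge_lt e f : bool :=
  (e.1 < f.1) || ((e.1 == f.1) && (e.2 < f.2)).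

Definition edge_le e f : bool := (e == f) || edge_lt e f.

Definition lex_edges G : seq (edge n) := sort edge_le (enum G).

(* The (l+1)st edge is the one of index l. *)
Definition lex_lt S T : Prop :=
  exists l : nat,
    [/\ l < size (lex_edges S), l < size (lex_edges T),
        take l (lex_edges S) = take l (lex_edges T) &
        edge_lt (nth (ord0, ord0) (lex_edges S) l)
                (nth (ord0, ord0) (lex_edges T) l)].

End Graphs.

Local Open Scope ring_scope.
Local Open Scope classical_set_scope.

Section Polytopes.
Variables (R : realType) (m : nat).
Implicit Types (A P F : set 'rV[R]_m).

Definition convex_hull A : set 'rV[R]_m :=
  [set x | exists (k : nat) (w : 'I_k -> R) (v : 'I_k -> 'rV[R]_m),
    [/\ forall i, 0 <= w i, \sum_(i < k) w i = 1, forall i, A (v i) &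
        x = \sum_(i < k) w i *: v i]].

(* The rows of M are affinely independent iff the rows (1, row i M) are
   linearly independent. *)
Definition has_aff_indep A (p : nat) : Prop :=
  exists M : 'M[R]_(p, m),
    (forall i, A (row i M)) /\ row_free (row_mx (const_mx 1 : 'cV[R]_p) M).

(* A has affine dimension d. *)
Definition affine_dim A (d : nat) : Prop :=
  has_aff_indep A d.+1 /\ ~ has_aff_indep A d.+2.

(* Face cut out by a supporting hyperplane {x | x *m a = c}. *)
Definition is_face P F : Prop :=
  exists (a : 'cV[R]_m) (c : R),
    (forall x, P x -> (x *m a) 0 0 <= c) /\
    F = [set x | P x /\ (x *m a) 0 0 = c].

Definition is_facet P F : Prop :=
  is_face P F /\ exists d : nat, affine_dim P d.+1 /\ affine_dim F d.

Definition is_union_of_facets P A : Prop :=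
  exists FF : set (set 'rV[R]_m),
    [/\ FF !=set0, (forall F, FF F -> is_facet P F) &
        A = \bigcup_(F in FF) F].

(* With 0-based indices, "for all 2 <= i <= k" is "for all i : 'I_k, 0 < i". *)
Definition is_shelling (k : nat) (F : 'I_k -> set 'rV[R]_m) : Prop :=
  forall i : 'I_k, (0 < i)%N ->
    is_union_of_facets (F i)
      (F i `&` \bigcup_(j in [set j : 'I_k | (j < i)%N]) F j).

End Polytopes.

Section RootPolytopes.
Variables (R : realType) (n : nat).

Definition root_vec (e : edge n) : 'rV[R]_n.+1 :=
  delta_mx 0 e.1 - delta_mx 0 e.2.

Definition full_root_polytope : set 'rV[R]_n.+1 :=
  convex_hull [set x | x = 0 \/
    exists e : edge n, (e.1 < e.2)%N /\ x = root_vec e].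

Definition root_cone (G : graph n) : set 'rV[R]_n.+1 :=
  [set x | exists c : edge n -> R,
    (forall e, 0 <= c e) /\ x = \sum_(e in G) c e *: root_vec e].

Definition root_polytope (G : graph n) : set 'rV[R]_n.+1 :=
  full_root_polytope `&` root_cone G.

End RootPolytopes.

Arguments root_vec R {n} e.
Arguments full_root_polytope R n : clear implicits.
Arguments root_cone R {n} G.
Arguments root_polytope R {n} G.

(* Main.v *)
Require Import Defs.
From mathcomp Require Import all_boot all_order all_algebra.
From mathcomp Require Import classical_sets reals.
From mathcomp Require Import zify lra.

(* The shelling condition reduces to a local one: if j < i, some edge e of T_i
   outside T_j can be exchanged for a smaller edge so that the result is again
   one of the trees.  Indeed on an alternating tree S the polytope P(S) is the
   simplex spanned by 0 and the edge vectors, and a point has only one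
   representation on a noncrossing alternating graph, so a common point of P(T_i)
   and P(T_j) has coefficient 0 on e and lies on the facet of P(T_i) opposite to
   e, which is also a face of the exchanged, earlier simplex.
   To find e, let f = (i, j) be the first edge by which T_j precedes T_i.  The
   edges of T_i in conflict with f are the (k, l) with i < k <= j < l; none of
   them is in T_j, and maximality of T_i among noncrossing alternating subgraphs
   of the closure forces them to form a chain in which consecutive edges share
   an endpoint.  Taking the largest k in the chain, with l as large as possible,
   and letting k' and l' be the neighbours of l and k next to k and l (l' = k if
   there is none), (k, l) can be exchanged for (k', l'). *)

Set Implicit Arguments.
Unset Strict Implicit.
Unset Printing Implicit Defensive.

Import Order.TTheory GRing.Theory Num.Theory.

(** * Noncrossing alternating trees *)

Section Combinatorics.
Variable n : nat.
Implicit Types (A B G S T : graph n) (e f g h : edge n).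

Lemma adj_sym G : symmetric (adj G).
Proof. by move=> x y; rewrite /adj orbC. Qed.

Lemma connect_adj_sym G : connect_sym (adj G).
Proof. by apply: sym_connect_sym; apply: adj_sym. Qed.

Lemma connect_adjS G S x y :
  G \subset S -> connect (adj G) x y -> connect (adj S) x y.
Proof.
move=> /fintype.subsetP sGS; apply: connect_sub => u v uv; apply: connect1.
by case/orP: uv => /sGS uv; rewrite /adj uv ?orbT.
Qed.

(** A path between the ends of [e] avoiding [e], once made repetition-free, closes up with [e] to a
    cycle. It has at least two steps, since [e] is not a loop and was deleted. *)
Lemma acyclic_bridge G e : is_graph G -> graph_acyclic G -> e \in G ->
  ~~ connect (adj (G :\ e)) e.1 e.2.
Proof.
move=> gG aG eG; apply/negP => /connectP[p0 p0P].
case/shortenP: p0P => p pP p_uniq _ e2E.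
have e12 := gG _ eG.
apply: (aG (e.1 :: p)); last first.
  apply/andP; split => //=; rewrite rcons_path; apply/andP; split.
    apply: sub_path pP => u v; rewrite /adj.
    by case/orP => /setD1P[_ ->]; rewrite ?orbT.
  by rewrite -e2E /adj -surjective_pairing eG orbT.
case: p pP e2E {p_uniq} => [|u [|v p]] //= pP e2E.
  by rewrite e2E ltnn in e12.
move: pP; rewrite -e2E andbT /adj -surjective_pairing.
case/orP => /setD1P[]; rewrite ?eqxx // => _ /gG /=.
by rewrite ltnNge ltnW.
Qed.

(* The two neighbouring edges of a shortest edge of a cycle cross. *)
Lemma noncrossing_alternating_acyclic G :
  is_graph G -> noncrossing G -> alternating G -> graph_acyclic G.
Proof.
move=> gG ncG altG c c_size /andP[c_cycle c_uniq].
(* With truncated subtraction, [(y - x) + (x - y)] is the distance of [x] and [y]. Here [z, x, y, w]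
   will be consecutive on the cycle, with [x], [y] at minimal distance. *)
have arith (w x y z : nat) : w != x -> z != y ->
    (y - x) + (x - y) <= (x - z) + (z - x) ->
    (y - x) + (x - y) <= (w - y) + (y - w) ->
    (x < y -> x < z -> w < y -> (w < x) && (y < z)) /\
    (y < x -> z < x -> y < w -> (z < y) && (x < w)) by lia.
have adjP x y : adj G x y -> (x < y /\ (x, y) \in G) \/ (y < x /\ (y, x) \in G).
  by case/orP => xy; [left|right]; split => //; have := gG _ xy.
have c0 : exists x, x \in c by case: (c) c_size => // x s _; exists x; rewrite inE eqxx.
case: c0 => x0 x0c.
pose len x := (next c x - x) + (x - next c x).
case: (arg_minnP (P := fun x => x \in c) len x0c) => x xc xmin.
pose y := next c x.
have yc : y \in c by rewrite mem_next.
have zc : prev c x \in c by rewrite mem_prev.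
have xy : adj G x y by apply: next_cycle.
have zx : adj G (prev c x) x by apply: prev_cycle.
have yw : adj G y (next c y) by apply: next_cycle.
have lz := xmin _ zc; have ly := xmin _ yc.
rewrite /len (next_prev c_uniq) -/y in lz ly.
(* If both neighbours of [x] agreed, the cycle would close after two vertices. *)
have zy : prev c x <> y.
  move=> zy; have yx : next c y = x by rewrite -zy next_prev.
  case/rot_to: xc => i s cE.
  have c'_uniq : uniq (x :: s) by rewrite -cE rot_uniq.
  have ny v : next c v = next (x :: s) v by rewrite -cE next_rot.
  move: yx; rewrite /y !ny; move: c'_uniq (c_size); rewrite -(size_rot i c) cE /=.
  case: s {cE ny} => [|a [|b s]] //=; rewrite !inE !eqxx => /andP[].
  rewrite !negb_or => /and3P[xa xb xs] /and3P[/andP[ab as_] _ _] _.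
  by rewrite eq_sym (negbTE xa) => bx; rewrite bx eqxx in xb.
have wx : next c y <> x by move=> wx; apply: zy; rewrite -wx prev_next.
have neq (u v : 'I_n.+1) : u <> v -> u != v :> nat by move=> uv; apply/eqP => /val_inj.
have [arith1 arith2] := arith _ _ _ _ (neq _ _ wx) (neq _ _ zy) lz ly.
(* Six of the eight orientations contain a directed path of two edges; the other two give
   crossings. *)
case: (adjP _ _ xy) => -[xyl xyG]; case: (adjP _ _ zx) => -[zxl zxG];
  case: (adjP _ _ yw) => -[ywl ywG].
- exact: altG zxl xyl (conj zxG xyG).
- exact: altG zxl xyl (conj zxG xyG).
- exact: altG xyl ywl (conj xyG ywG).
- have /andP[wx' yz] := arith1 xyl zxl ywl.
  exact: ncG wx' xyl yz (conj ywG zxG).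
- have /andP[zy' xw] := arith2 xyl zxl ywl.
  exact: ncG zy' xyl xw (conj zxG ywG).
- exact: altG ywl xyl (conj ywG xyG).
- exact: altG xyl zxl (conj xyG zxG).
- exact: altG ywl xyl (conj ywG xyG).
Qed.

(** * Maximality of connected noncrossing alternating graphs *)

Lemma noncrossing_setU1 A (i j : 'I_n.+1) : noncrossing A ->
  (forall a b : 'I_n.+1, (a, b) \in A -> i < a -> a < j -> j < b -> False) ->
  (forall a b : 'I_n.+1, (a, b) \in A -> a < i -> i < b -> b < j -> False) ->
  noncrossing ((i, j) |: A).
Proof.
move=> ncA hR hL a b c d ab bc cd [/setU1P[[ai cj]|acA] /setU1P[[bi dj]|bdA]].
- by subst; rewrite ltnn in ab.
- by subst; apply: hR bdA _ _ _.
- by subst; apply: hL acA _ _ _.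
- exact: ncA ab bc cd (conj acA bdA).
Qed.

Lemma alternating_setU1 A (i j : 'I_n.+1) : alternating A ->
  i < j ->
  (forall a : 'I_n.+1, (a, i) \in A -> a < i -> False) ->
  (forall b : 'I_n.+1, (j, b) \in A -> j < b -> False) ->
  alternating ((i, j) |: A).
Proof.
move=> altA ij hi hj a b c ab bc [/setU1P[[ai bj]|abA] /setU1P[[bi cj]|bcA]].
- by subst; rewrite ltnn in ab.
- by subst; apply: hj bcA _.
- by subst; apply: hi abA _.
- exact: altA ab bc (conj abA bcA).
Qed.

Lemma is_graph_setU1 A (i j : 'I_n.+1) : is_graph A -> i < j ->
  is_graph ((i, j) |: A).
Proof. by move=> gA ij e /setU1P[->|/gA]. Qed.

Lemma noncrossing_sub A B : A \subset B -> noncrossing B -> noncrossing A.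
Proof.
move=> /fintype.subsetP sAB ncB i j k l ij jk kl [/sAB ik /sAB jl].
exact: ncB ij jk kl (conj ik jl).
Qed.

Lemma alternating_sub A B : A \subset B -> alternating B -> alternating A.
Proof.
move=> /fintype.subsetP sAB altB i j k ij jk [/sAB ik /sAB jl].
exact: altB ij jk (conj ik jl).
Qed.

(** Otherwise adding [(i, j)] keeps the graph acyclic, so [(i, j)] is a bridge of it; but its ends
    are already connected in [A]. *)
Lemma noncrossing_alternating_maximal A (i j : 'I_n.+1) :
  is_graph A -> graph_connected A -> noncrossing A -> alternating A -> i < j ->
  (forall a b : 'I_n.+1, (a, b) \in A -> i < a -> a < j -> j < b -> False) ->
  (forall a b : 'I_n.+1, (a, b) \in A -> a < i -> i < b -> b < j -> False) ->
  (forall a : 'I_n.+1, (a, i) \in A -> a < i -> False) ->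
  (forall b : 'I_n.+1, (j, b) \in A -> j < b -> False) ->
  (i, j) \in A.
Proof.
move=> gA cA ncA altA ij h1 h2 h3 h4; apply/negPn/negP => ijA.
have gA' := is_graph_setU1 gA ij.
have acA' := noncrossing_alternating_acyclic gA' (noncrossing_setU1 ncA h1 h2)
  (alternating_setU1 altA ij h3 h4).
have := acyclic_bridge gA' acA' (setU11 _ _).
by rewrite setU1K //= cA.
Qed.

(** * Crossing directed paths *)

Section Reachability.
Variable T : graph n.
Hypotheses (gT : is_graph T) (ncT : noncrossing T).

Definition reach : rel 'I_n.+1 := connect (fun x y => (x, y) \in T).

Lemma reach_trans : transitive reach.
Proof. exact: connect_trans. Qed.

Lemma reach_le (x y : 'I_n.+1) : reach x y -> x <= y.
Proof.
case/connectP => p; elim: p x => [|z p IHp] x /=; first by move=> _ ->.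
by case/andP => /gT /= xz zp yE; have := IHp z zp yE; lia.
Qed.

Lemma reach_step (x y : 'I_n.+1) : reach x y -> x < y ->
  exists z, [/\ (x, z) \in T, x < z & reach z y].
Proof.
case/connectP => -[|z p] /=; first by move=> _ ->; rewrite ltnn.
case/andP => xz zp yE _; exists z; split => //; first exact: (gT xz).
by apply/connectP; exists p.
Qed.

(** The induction advances [a] by one step if this stays at or before [b]. Otherwise the step passes
    over [b], and the first step from [b] cannot go beyond its end without crossing it, so [b]
    advances. *)
Lemma reach_crossing (a b c d : 'I_n.+1) : a <= b -> b <= c -> c <= d ->
  reach a c -> reach b d ->
  exists m, [/\ reach a m, reach m c, reach b m & reach m d].
Proof.
have [k] := ubnP ((c - a) + (d - b)).
elim: k a b => // k IHk a b ltk ab bc cd ac bd.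
have [abE|ab'] := eqVneq a b.
  by exists a; rewrite abE in ac *; split => //; apply: connect0.
have [bcE|bc'] := eqVneq b c.
  by exists b; rewrite bcE in bd *; split => //; apply: connect0.
have [cdE|cd'] := eqVneq c d.
  by exists c; rewrite -cdE in bd *; split => //; apply: connect0.
rewrite -!val_eqE /= in ab' bc' cd'.
have [|a1 [aa1T aa1 a1c]] := reach_step ac; first lia.
have a1c_le := reach_le a1c.
have aa1r : reach a a1 by apply: connect1.
case: (leqP a1 b) => a1b.
  have [|m [h1 h2 h3 h4]] := IHk a1 b _ a1b bc cd a1c bd; first lia.
  by exists m; split => //; apply: reach_trans h1.
have [|b1 [bb1T bb1 b1d]] := reach_step bd; first lia.
have b1a1 : b1 <= a1.
  by rewrite leqNgt; apply/negP => a1b1; apply: (ncT _ a1b a1b1 (conj aa1T bb1T)); lia.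
have [|||m [h1 h2 h3 h4]] := IHk a b1 _ _ _ cd ac b1d.
- by move: ltk bb1 b1a1 a1c_le cd; clear; lia.
- exact: leq_trans ab (ltnW bb1).
- exact: leq_trans b1a1 a1c_le.
by exists m; split => //; apply: reach_trans h3; apply: connect1.
Qed.

Lemma reach_crossing_outer (a b c d : 'I_n.+1) : a <= b -> b <= c -> c <= d ->
  reach a c -> reach b d -> reach a d.
Proof.
move=> ab bc cd ac bd; have [m [am _ _ md]] := reach_crossing ab bc cd ac bd.
exact: reach_trans am md.
Qed.

Lemma reach_crossing_inner (a b c d : 'I_n.+1) : a <= b -> b <= c -> c <= d ->
  reach a c -> reach b d -> reach b c.
Proof.
move=> ab bc cd ac bd; have [m [_ mc bm _]] := reach_crossing ab bc cd ac bd.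
exact: reach_trans bm mc.
Qed.

Lemma mem_tclosure x y : ((x, y) \in tclosure T) = (x < y) && reach x y.
Proof. by rewrite inE. Qed.

End Reachability.

(** * Lexicographic comparison and edge exchange *)

Lemma edge_le_trans : transitive (@edge_le n).
Proof.
move=> [a b] [c d] [u v]; rewrite /edge_le /edge_lt /= !xpair_eqE -!val_eqE /=.
lia.
Qed.

Lemma edge_le_total : total (@edge_le n).
Proof.
move=> [a b] [c d]; rewrite /edge_le /edge_lt /= !xpair_eqE -!val_eqE /=; lia.
Qed.

Lemma mem_lex_edges G : lex_edges G =i G.
Proof. by move=> e; rewrite mem_sort mem_enum. Qed.

Lemma lex_lt_first_diff S T : lex_lt S T ->
  exists f, [/\ f \in S, f \notin T &
    forall h, edge_lt h f -> h \in T -> h \in S].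
Proof.
case=> l [lS lT eq_take lt_nth].
set f := nth _ (lex_edges S) l in lt_nth.
have fS : f \in lex_edges S by apply: mem_nth.
have uS : uniq (lex_edges S) by rewrite sort_uniq enum_uniq.
have sT : sorted (@edge_le n) (lex_edges T) by apply: sort_sorted; apply: edge_le_total.
(* From index [l] on, all entries of [T] exceed [f], so edges of [T] up to [f] lie in the common
   prefix. *)
have take_below h : edge_le h f -> h \in T -> h \in take l (lex_edges S).
  rewrite -mem_lex_edges => hf hT; rewrite eq_take in_take //.
  rewrite ltnNge; apply/negP => lh.
  have refl : reflexive (@edge_le n) by move=> x; rewrite /edge_le eqxx.
  have := sorted_leq_nth (@edge_le_trans) refl (ord0, ord0) sT l (index h (lex_edges T)).
  rewrite !inE lT index_mem hT nth_index // => /(_ isT isT lh); move: hf lt_nth; move: (nth _ _ _) => g; clear.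
  case: h f g => [a b] [c d] [u v].
  rewrite /edge_le /edge_lt /= !xpair_eqE -!val_eqE /=; lia.
exists f; split; first by rewrite -mem_lex_edges.
  apply/negP => fT; have := take_below f.
  rewrite /edge_le eqxx fT => /(_ isT isT).
  by rewrite in_take // /f index_uniq // ltnn.
move=> h hf hT; rewrite -mem_lex_edges; apply: (@mem_take l).
by apply: take_below => //; rewrite /edge_le hf orbT.
Qed.

(** Acyclicity comes from the noncrossing and alternating conditions, connectivity from the path
    replacing [e]. A smaller edge already in [A] would make the new graph [A :\ e], in which the
    ends of the bridge [e] are disconnected. *)
Lemma spanning_tree_exchange A e (i j : 'I_n.+1) :
  is_tree A -> e \in A -> i < j ->
  noncrossing ((i, j) |: (A :\ e)) -> alternating ((i, j) |: (A :\ e)) ->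
  connect (adj ((i, j) |: (A :\ e))) e.1 e.2 ->
  is_tree ((i, j) |: (A :\ e)) /\ (edge_lt (i, j) e -> (i, j) \notin A).
Proof.
move=> [gA cA aA] eA ij nc alt ce; set A' := _ |: _ in nc alt ce *.
have gA' : is_graph A'.
  by apply: is_graph_setU1 ij => h /setD1P[_ /gA].
have edge_conn u v : (u, v) \in A -> connect (adj A') u v.
  move=> uvA; have [uve|uve] := eqVneq (u, v) e; first by move: ce; rewrite -uve.
  by apply: connect1; rewrite /adj !inE uve uvA orbT.
split; last first.
  move=> lt_e; apply/negP => ijA; have := acyclic_bridge gA aA eA; apply/negP/negPn.
  suff <- : A' = A :\ e by [].
  apply/finset.setUidPr; rewrite finset.sub1set !inE ijA andbT.
  by apply: contraTneq lt_e => ->; rewrite /edge_lt !ltnn andbF.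
split => //; last exact: noncrossing_alternating_acyclic.
move=> x y; apply: connect_sub (cA x y) => u v /orP[|] /edge_conn //.
by rewrite connect_adj_sym.
Qed.

Lemma lex_decreasing_flip T A B f :
  is_graph T -> noncrossing T ->
  spanning_tree_of (tclosure T) A -> noncrossing A -> alternating A ->
  B \subset tclosure T -> noncrossing B -> alternating B ->
  f \in B -> f \notin A -> (forall h, edge_lt h f -> h \in A -> h \in B) ->
  exists e g, [/\ e \in A, e \notin B, g \notin A, edge_lt g e &
    [/\ spanning_tree_of (tclosure T) (g |: (A :\ e)),
      noncrossing (g |: (A :\ e)) & alternating (g |: (A :\ e))]].
Proof.
move=> gT ncT [tA sAT] ncA altA sBT ncB altB.
have [gA cA _] := tA.
case: f => i j fB fA ltf.
have AT a b : (a, b) \in A -> reach T a b.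
  by move/(fintype.subsetP sAT); rewrite mem_tclosure => /andP[].
have [ij rij] : i < j /\ reach T i j.
  by move/(fintype.subsetP sBT): fB; rewrite mem_tclosure => /andP.
have gA2 a b : (a, b) \in A -> a < b by move/gA.
(* Edges starting before [i] precede [f], so those of [A] are in [B] and thus compatible with
   [f]. *)
have small (a b : 'I_n.+1) : a < i -> (a, b) \in A -> (a, b) \in B.
  by move=> ai; apply: ltf; rewrite /edge_lt /= ai.
have no_in_i (a : 'I_n.+1) : (a, i) \in A -> a < i -> False.
  by move=> ai_A ai; apply: (altB a i j) => //; split=> //; apply: small.
have no_cross_left (a b : 'I_n.+1) : (a, b) \in A -> a < i -> i < b -> b < j -> False.
  by move=> abA ai ib bj; apply: (ncB a i b j) => //; split=> //; apply: small.
(* An edge of [X] crosses [f] if it starts before [j], and breaks alternation with [f] if it starts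
   at [j]. *)
pose X := [set e : edge n | (e \in A) && [&& i < e.1, e.1 <= j & j < e.2]].
have XP (a b : 'I_n.+1) : (a, b) \in A -> i < a -> a <= j -> j < b -> (a, b) \in X.
  by move=> abA ia aj jb; rewrite inE abA /= ia aj jb.
have XB a b : (a, b) \in X -> (a, b) \notin B.
  rewrite inE /= => /and4P[abA ia aj jb]; apply/negP => abB.
  case: (ltngtP a j) aj => // [aj _|/val_inj aj _].
    exact: (ncB i a j b ia aj jb (conj fB abB)).
  by subst a; apply: (altB i j b ij jb (conj fB abB)).
have [e0 e0X] : exists e, e \in X.
  apply/finset.set0Pn/eqP => X0; move/negP: fA; apply.
  apply: noncrossing_alternating_maximal => //.
    by move=> a b abA ia aj jb; have := XP a b abA ia (ltnW aj) jb; rewrite X0 inE.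
  by move=> b jbA jb; have := XP j b jbA ij (leqnn j) jb; rewrite X0 inE.
case: e0 e0X => k0 l0 kl0X.
have [k [l1 [kl1X kmax]]] : exists k l1 : 'I_n.+1, (k, l1) \in X /\
   (forall a b : 'I_n.+1, (a, b) \in X -> a <= k).
  case: (arg_maxnP (P := mem X) (fun e : edge n => val e.1) kl0X) => -[k l] klX max_k.
  by exists k, l; split=> // a b /max_k.
have {kl1X} [l [klX lmax]] : exists l : 'I_n.+1, (k, l) \in X /\
   (forall b : 'I_n.+1, (k, b) \in X -> b <= l).
  case: (arg_maxnP (P := fun l => (k, l) \in X) (fun l => val l) kl1X) => l klX max_l.
  by exists l; split=> // b /max_l.
have /and4P[/= klA ik kj jl] : [&& (k, l) \in A, i < k, k <= j & j < l].
  by move: klX; rewrite inE.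
(* Since X is a chain, k' is either i or the source preceding k in X. *)
have [k' [/andP[ik' k'k] rk'j nk' k'alt k'max]] : exists k' : 'I_n.+1, [/\ i <= k' < k,
    reach T k' j,
    forall a b : 'I_n.+1, (a, b) \in A -> a < k' -> k' < b -> b < j -> False,
    forall a : 'I_n.+1, (a, k') \in A -> a < k' -> False &
    forall a b : 'I_n.+1, (a, b) \in X -> k' < a -> k <= a].
  pose P (a : 'I_n.+1) := (a < k) && ((a == i) || [exists b, (a, b) \in X]).
  have Pi : P i by rewrite /P ik eqxx.
  case: (arg_maxnP (P := P) (fun a => val a) Pi) => k' /andP[k'k k'P] max_k'.
  have {}max_k' c : P c -> c <= k' by move/max_k'.
  have max_a a b : (a, b) \in X -> k' < a -> k <= a.
    move=> abX k'a; rewrite leqNgt; apply/negP => ak.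
    suff /max_k' : P a by rewrite leqNgt k'a.
    by rewrite /P ak; apply/orP; right; apply/existsP; exists b.
  case/orP: k'P => [/eqP k'i|/existsP[b k'bX]].
    by exists i; subst k'; rewrite leqnn; split.
  have /and4P[/= k'bA ik' k'j jb] : [&& (k', b) \in A, i < k', k' <= j & j < b].
    by move: k'bX; rewrite inE.
  exists k'; rewrite (ltnW ik') k'k; split => //.
  - exact: reach_crossing_inner (ltnW ik') k'j (ltnW jb) rij (AT _ _ k'bA).
  - move=> a c acA ak' k'c cj.
    exact: ncA ak' k'c (ltn_trans cj jb) (conj acA k'bA).
  - by move=> a ak'A ak'; apply: altA ak' (gA2 _ _ k'bA) (conj ak'A k'bA).
(* An obstruction would conflict with [(k, l)], start at [k] and end beyond [l], or be excluded by
   the choice of [k']. *)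
have k'lA : (k', l) \in A.
  apply: noncrossing_alternating_maximal => //.
  - by move: k'k kj jl; clear; lia.
  - move=> a b abA k'a al lb.
    case: (ltnP k a) => ka; first exact: ncA ka al lb (conj klA abA).
    have abX : (a, b) \in X by apply: XP => //; move: ik' k'a ka kj jl lb; clear; lia.
    have /val_inj ak : a = k :> nat by apply/eqP; rewrite eqn_leq ka (k'max _ _ abX).
    by subst a; have := lmax _ abX; rewrite leqNgt lb.
  - move=> a b abA ak' k'b bl.
    case: (ltngtP k b) => kb.
    + exact: ncA (ltn_trans ak' k'k) kb bl (conj abA klA).
    + by apply: nk' abA ak' k'b _; exact: leq_trans kb kj.
    + have {kb} bk : b = k by apply: val_inj.
      by subst b; apply: altA (ltn_trans ak' k'k) (gA2 _ _ klA) (conj abA klA).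
  - by move=> b lbA lb; apply: altA (gA2 _ _ klA) lb (conj klA lbA).
(* An obstruction would conflict with [(k, l)] or be an edge of [X] starting beyond [k]. *)
have kjA : k < j -> (k, j) \in A.
  move=> kj'; apply: noncrossing_alternating_maximal => //.
  - move=> a b abA ka aj jb.
    have abX : (a, b) \in X by apply: XP => //; [exact: ltn_trans ka|exact: ltnW].
    by have := kmax _ _ abX; rewrite leqNgt ka.
  - by move=> a b abA ak kb bj; apply: ncA ak kb (ltn_trans bj jl) (conj abA klA).
  - by move=> a akA ak; apply: altA ak (gA2 _ _ klA) (conj akA klA).
  - move=> b jbA jb; have jbX : (j, b) \in X by apply: XP.
    by have := kmax _ _ jbX; rewrite leqNgt kj'.
(* l' = k = j when j is a leaf; (j, l) is then exchanged for (k', j). *)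
have [l' [jl' l'l kl' l'max]] : exists l' : 'I_n.+1, [/\ j <= l', l' < l,
    (k, l') \in A \/ k = l' /\ l' = j &
    forall b : 'I_n.+1, (k, b) \in A -> l' < b -> l <= b].
  pose P (b : 'I_n.+1) := [&& j <= b, b < l & (b == j) || ((k, b) \in A)].
  have Pj : P j by rewrite /P leqnn jl eqxx.
  case: (arg_maxnP (P := P) (fun a => val a) Pj) => l' /and3P[jl' l'l l'P] max_l'.
  have {}max_l' c : P c -> c <= l' by move/max_l'.
  exists l'; split => //.
    case/orP: l'P => [/eqP l'j|]; last by left.
    subst l'; have [->|kj'] := eqVneq k j; first by right.
    by left; apply: kjA; rewrite ltn_neqAle kj'.
  move=> b kbA l'b; rewrite leqNgt; apply/negP => bl.
  suff /max_l' : P b by rewrite leqNgt l'b.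
  by rewrite /P bl kbA orbT (leq_trans jl' (ltnW l'b)).
have k'l' : k' < l' by move: k'k kj jl'; clear; lia.
(* An edge [(k, l')] interleaves with the path from [k'] to [j]; the two meet and together lead from
   [k'] to [l']. *)
have rk'l' : reach T k' l'.
  case: kl' => [kl'A|[_ ->]] //.
  exact: reach_crossing_outer (ltnW k'k) kj jl' rk'j (AT _ _ kl'A).
have lt_e : edge_lt (k', l') (k, l) by rewrite /edge_lt /= k'k.
pose A' := (k', l') |: (A :\ (k, l)).
have sAA : A :\ (k, l) \subset A by apply: finset.subD1set.
have ncA' : noncrossing A'.
  apply: noncrossing_setU1; first exact: noncrossing_sub ncA.
  (* As [(k', l)] is in [A], the crossing edge ends at or before [l]. Starting before [k], it would
     cross [(k, l)] or contradict the choice of [k']; starting after [k], it would cross [(k, l')].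
     So it starts at [k], and by the choice of [l'] it is the removed edge. *)
  - move=> a b /setD1P[abkl abA] k'a al' l'b.
    have lb : b <= l.
      rewrite leqNgt; apply/negP => lb.
      exact: ncA k'a (ltn_trans al' l'l) lb (conj k'lA abA).
    case: (ltngtP a k) => ak.
    + case: (ltngtP b l) lb => // [bl _|/val_inj bl _].
        by apply: ncA ak _ bl (conj abA klA); move: kj jl' l'b; clear; lia.
      subst b; have alX : (a, l) \in X.
        by apply: XP => //; move: ik' k'a ak kj jl; clear; lia.
      by have := k'max _ _ alX k'a; rewrite leqNgt ak.
    + case: kl' => [kl'A|[kl' _]]; first exact: ncA ak al' l'b (conj kl'A abA).
      by move: ak; rewrite kl' ltnNge (ltnW al').
    + have {ak} ak : a = k by apply: val_inj.
      subst a; have := l'max _ abA l'b; move=> lb'.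
      have bl : b = l by apply: val_inj; apply/eqP; rewrite eqn_leq lb.
      by rewrite bl eqxx in abkl.
  - move=> a b /setD1P[_ abA] ak' k'b bl'.
    exact: ncA ak' k'b (ltn_trans bl' l'l) (conj abA k'lA).
have altA' : alternating A'.
  apply: alternating_setU1 => //; first exact: alternating_sub altA.
    by move=> a /setD1P[_ ak'A] ak'; apply: k'alt ak'.
  move=> b /setD1P[bkl l'bA] l'b.
  case: kl' => [kl'A|[kl' l'j]]; first exact: altA (gA2 _ _ kl'A) l'b (conj kl'A l'bA).
  subst l'; subst k; have jbX : (j, b) \in X by apply: XP.
  have bl : b = l.
    by apply: val_inj; apply/eqP; rewrite eqn_leq lmax // l'max.
  by rewrite bl eqxx in bkl.
have A'conn u v : (u, v) \in A -> (u, v) != (k, l) -> connect (adj A') u v.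
  by move=> uvA uvN; apply: connect1; rewrite /adj !inE uvN uvA orbT.
(* The path [k], [l'], [k'], [l] replaces the removed edge; its first step is empty when
   [l' = k]. *)
have conn_e : connect (adj A') k l.
  apply: (@connect_trans _ _ k').
    apply: (@connect_trans _ _ l').
      case: kl' => [kl'A|[-> _]]; last exact: connect0.
      by apply: A'conn kl'A _; rewrite xpair_eqE -!val_eqE /= (ltn_eqF l'l) andbF.
    by apply: connect1; rewrite /adj !inE eqxx orbT.
  by apply: A'conn k'lA _; rewrite xpair_eqE -!val_eqE /= (ltn_eqF k'k).
have [tA' nA'] := spanning_tree_exchange tA klA k'l' ncA' altA' conn_e.
exists (k, l), (k', l'); split => //; [exact: XB|exact: nA'|split => //].
split => //; apply/fintype.subsetP => h /setU1P[->|/setD1P[_ hA]].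
  by rewrite mem_tclosure k'l'.
exact: (fintype.subsetP sAT).
Qed.

End Combinatorics.
(** * Root polytopes *)

Section Geometry.
Local Open Scope ring_scope.
Local Open Scope classical_set_scope.
Variables (R : realType) (n : nat).
Implicit Types (A S T : graph n) (e : edge n) (c d : edge n -> R).

(** The convex hull of the origin and the edge vectors of [A]: the slack in the sum of coefficients
    is the weight of the origin. *)
Definition root_simplex A : set 'rV[R]_n.+1 :=
  [set x | exists c : edge n -> R,
    [/\ forall e, 0 <= c e, \sum_(e in A) c e <= 1 &
        x = \sum_(e in A) c e *: root_vec R e]].

Lemma mulmx_root_vec (f : 'I_n.+1 -> R) e :
  (root_vec R e *m \col_u f u) 0 0 = f e.1 - f e.2.
Proof. by rewrite /root_vec mulmxBl -!rowE !mxE. Qed.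

Lemma mulmx_sum_root_vec (P : pred (edge n)) c (f : 'I_n.+1 -> R) :
  ((\sum_(e | P e) c e *: root_vec R e) *m \col_u f u) 0 0 =
  \sum_(e | P e) c e * (f e.1 - f e.2).
Proof.
rewrite mulmx_suml summxE; apply: eq_bigr => e _.
by rewrite -scalemxAl mxE mulmx_root_vec.
Qed.

(* On an alternating graph, the sum of the coordinates at the sources equals 1
   on every edge vector, and it is at most 1 on every root. *)
Lemma root_polytopeE S : is_graph S -> alternating S ->
  root_polytope R S = root_simplex S.
Proof.
move=> gS altS; apply/seteqP; split => x.
  case=> -[k [w [v [w0 w1 vP xE]]]] [c [c0 xcE]]; exists c; split => //.
  pose f (u : 'I_n.+1) : R := [exists v, (u, v) \in S]%:R.
  have f01 u : 0 <= f u <= 1 by rewrite /f; case: [exists _, _]; rewrite ?lexx ?ler01.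
  have : (x *m \col_u f u) 0 0 = \sum_(e in S) c e.
    rewrite xcE mulmx_sum_root_vec; apply: eq_bigr => -[i j] ijS /=.
    rewrite /f; have -> : [exists v, (i, v) \in S] by apply/existsP; exists j.
    have /negbTE-> : ~~ [exists v, (j, v) \in S].
      apply/existsP => -[l jlS].
      exact: altS (gS _ ijS) (gS _ jlS) (conj ijS jlS).
    by rewrite subr0 mulr1.
  move=> <-; rewrite xE mulmx_suml summxE -w1; apply: ler_sum => i _.
  rewrite -scalemxAl mxE ler_piMr //.
  case: (vP i) => [->|[e [_ ->]]]; first by rewrite mul0mx mxE ler01.
  rewrite mulmx_root_vec; have := f01 e.1; have := f01 e.2; lra.
case=> c [c0 c1 xE]; split; last by exists c.
(* [None] indexes the origin and takes the slack; pairs outside [S] get weight 0. *)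
pose w (o : option (edge n)) : R :=
  if o is Some e then (if e \in S then c e else 0) else 1 - \sum_(e in S) c e.
pose v (o : option (edge n)) : 'rV[R]_n.+1 :=
  if o is Some e then (if e \in S then root_vec R e else 0) else 0.
have sum_opt (V : nmodType) (F : option (edge n) -> V) :
    \sum_(i < #|{: option (edge n)}|) F (enum_val i) = F None + \sum_e F (Some e).
  rewrite -(big_enum_val F) (bigD1 None) //=; congr (_ + _).
  rewrite (reindex_omap Some id) /=; last by case.
  by apply: eq_bigl => e; rewrite eqxx.
exists #|{: option (edge n)}|, (fun i => w (enum_val i)), (fun i => v (enum_val i)).
split.
- move=> i; rewrite /w; case: (enum_val i) => [e|]; first by case: ifP.
  by rewrite subr_ge0.
- by rewrite sum_opt /= -big_mkcond /= subrK.
- move=> i; rewrite /v; case: (enum_val i) => [e|]; last by left.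
  by case: ifP => eS; [right; exists e; split=> //; exact: gS|left].
rewrite (sum_opt _ (fun o => w o *: v o)) /= scaler0 add0r xE big_mkcond /=.
by apply: eq_bigr => e _; case: ifP; rewrite ?scaler0.
Qed.

(** Coefficients on a common larger [S], vanishing off [A], allow points of different simplices to
    be compared. *)
Lemma root_simplexP A S x : A \subset S ->
  root_simplex A x <->
  exists c, [/\ forall e, 0 <= c e, forall e, e \notin A -> c e = 0,
    \sum_(e in S) c e <= 1 & x = \sum_(e in S) c e *: root_vec R e].
Proof.
move=> /fintype.subsetP sAS.
have sumE (V : nmodType) (F : edge n -> V) : (forall e, e \notin A -> F e = 0) ->
    \sum_(e in S) F e = \sum_(e in A) F e.
  move=> F0; rewrite (bigID (mem A)) /= [X in _ + X]big1 ?addr0.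
    by apply: eq_bigl => e; rewrite andbC; case: (boolP (e \in A)) => // /sAS.
  by move=> e /andP[_ /F0].
split=> [[c [c0 c1 xE]]|[c [c0 cA c1 xE]]]; last first.
  exists c; split; rewrite -?sumE // => e /cA ->; exact: scale0r.
exists (fun e => if e \in A then c e else 0).
have A0 e : e \notin A -> (if e \in A then c e else 0) = 0 by move/negbTE->.
split=> [e|||] //; first by case: ifP.
  rewrite sumE // -big_mkcondr; apply: le_trans c1.
  by rewrite (eq_bigl (mem A)) // => e; rewrite andbb.
rewrite sumE => [|e /A0 ->]; last exact: scale0r.
by rewrite xE; apply: eq_bigr => e ->.
Qed.

(** * Flows and uniqueness of coefficients *)

Definition outflow c (u : 'I_n.+1) := \sum_(e | e.1 == u) c e.
Definition inflow c (u : 'I_n.+1) := \sum_(e | e.2 == u) c e.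

Lemma sum_root_vec_flow c u :
  (\sum_e c e *: root_vec R e) 0 u = outflow c u - inflow c u.
Proof.
rewrite summxE /outflow /inflow (big_mkcond (fun e : edge n => e.1 == u)) /=.
rewrite (big_mkcond (fun e : edge n => e.2 == u)) /= -sumrB.
apply: eq_bigr => e _; rewrite !mxE !eqxx /= mulrBr ![u == _]eq_sym.
by case: eqP; case: eqP; rewrite ?mulr1 ?mulr0.
Qed.

(** No vertex is both the start of one edge and the end of another. For nonnegative [c], the net
    flow at a vertex therefore determines its outflow and inflow. *)
Lemma alternating_flow S c : is_graph S -> alternating S ->
  (forall e, e \notin S -> c e = 0) ->
  forall u, outflow c u = 0 \/ inflow c u = 0.
Proof.
move=> gS altS cS u.
have [/existsP[v uvS]|noS] := boolP [exists v, (u, v) \in S]; [right|left];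
  apply: big1 => -[a b] /= /eqP abu; apply: cS; subst u.
  apply/negP => abS; exact: altS (gS _ abS) (gS _ uvS) (conj abS uvS).
by apply: contra noS => abS; apply/existsP; exists b.
Qed.

(* In a noncrossing flow supply is matched to demand last in, first out: if T
   used (i, j) less than S does, it would feed j from some i' < i instead, and
   could not ship the rest of the supply of i beyond j. *)
Lemma noncrossing_flow_le S T c d (e0 : edge n) :
  is_graph S -> noncrossing T ->
  (forall e, 0 <= c e) -> (forall e, 0 <= d e) ->
  (forall e, e \notin S -> c e = 0) -> (forall e, e \notin T -> d e = 0) ->
  outflow c =1 outflow d -> inflow c =1 inflow d ->
  (forall e, (e.2 < e0.2)%N -> c e = d e) ->
  (forall e, e.2 = e0.2 -> (e0.1 < e.1)%N -> c e = d e) ->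
  c e0 <= d e0.
Proof.
move=> gS ncT c0 d0 cS dT out_eq in_eq eq_before eq_after.
rewrite leNgt; apply/negP => lt_dc.
have e0S : e0 \in S.
  apply/negPn/negP => /cS c0E; move: lt_dc; rewrite c0E ltNge d0 //.
have [e1 /andP[/eqP e12 lt_cd]] : exists e, (e.2 == e0.2) && (c e < d e).
  apply/existsP/contraT; rewrite negb_exists => /forallP no_e.
  have : inflow d e0.2 < inflow c e0.2.
    rewrite /inflow (bigD1 e0) //= [ltRHS](bigD1 e0) //=.
    apply: ltr_leD => //; apply: ler_sum => e /andP[/eqP ee0 _].
    by have := no_e e; rewrite ee0 eqxx /= -leNgt.
  by rewrite in_eq ltxx.
have e11 : (e1.1 < e0.1)%N.
  case: (ltngtP e1.1 e0.1) => // e11.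
    by move: lt_cd; rewrite eq_after // ltxx.
  move: lt_cd lt_dc; have -> : e1 = e0.
    apply/eqP; rewrite -pair_eqE /pair_eq e12 eqxx andbT; exact/eqP/val_inj.
  by move=> /lt_trans /[apply]; rewrite ltxx.
have e1T : e1 \in T.
  apply/negPn/negP => /dT d0E; move: lt_cd; rewrite d0E ltNge c0 //.
have : outflow d e0.1 < outflow c e0.1.
  rewrite /outflow (bigD1 e0) //= [ltRHS](bigD1 e0) //=.
  apply: ltr_leD => //; apply: ler_sum => e /andP[/eqP ee0 ne0].
  case: (ltngtP e.2 e0.2) => e2.
  - by rewrite eq_before.
  - rewrite dT ?c0 //; apply/negP => eT.
    apply: (ncT e1.1 e0.1 e0.2 e.2 e11 (gS _ e0S) e2).
    by rewrite -e12 -ee0 -!surjective_pairing.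
  - by case/eqP: ne0; rewrite [e]surjective_pairing [RHS]surjective_pairing ee0 (val_inj e2).
by rewrite out_eq ltxx.
Qed.

(** By alternation the point determines all outflows and inflows; at the first edge where [c] and
    [d] differ, [noncrossing_flow_le] then applies in both directions. *)
Lemma noncrossing_alternating_unique S T c d :
  is_graph S -> noncrossing S -> alternating S ->
  is_graph T -> noncrossing T -> alternating T ->
  (forall e, 0 <= c e) -> (forall e, 0 <= d e) ->
  (forall e, e \notin S -> c e = 0) -> (forall e, e \notin T -> d e = 0) ->
  \sum_e c e *: root_vec R e = \sum_e d e *: root_vec R e -> c =1 d.
Proof.
move=> gS ncS altS gT ncT altT c0 d0 cS dT cd_eq.
have flow_eq u : outflow c u = outflow d u /\ inflow c u = inflow d u.
  have : outflow c u - inflow c u = outflow d u - inflow d u.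
    by rewrite -!sum_root_vec_flow cd_eq.
  have : 0 <= outflow c u by apply: sumr_ge0.
  have : 0 <= outflow d u by apply: sumr_ge0.
  have : 0 <= inflow c u by apply: sumr_ge0.
  have : 0 <= inflow d u by apply: sumr_ge0.
  case: (alternating_flow gS altS cS u) => ->;
  case: (alternating_flow gT altT dT u) => ->; lra.
have out_eq u : outflow c u = outflow d u by case: (flow_eq u).
have in_eq u : inflow c u = inflow d u by case: (flow_eq u).
move=> e; apply/eqP/negPn/negP => ne.
(* Edges are ranked by increasing second vertex, then by decreasing first vertex; the factor [n.+1]
   exceeds every [n - e.1]. *)
pose rk e := (e.2 * n.+1 + (n - e.1))%N.
case: (arg_minnP (P := fun e => c e != d e) rk ne) => e0 ne0 min_e0.
have eq_rk e' : (rk e' < rk e0)%N -> c e' = d e'.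
  by move=> lt_rk; apply/eqP; apply: contraLR lt_rk => /min_e0; rewrite -leqNgt.
have eq_before e' : (e'.2 < e0.2)%N -> c e' = d e'.
  move=> lt_e; apply: eq_rk; rewrite /rk.
  have : (e'.2.+1 * n.+1 <= e0.2 * n.+1)%N by rewrite leq_mul2r lt_e orbT.
  rewrite mulSn; move: (e'.2 * n.+1)%N (e0.2 * n.+1)%N; clear; lia.
have eq_after e' : e'.2 = e0.2 -> (e0.1 < e'.1)%N -> c e' = d e'.
  move=> e2 lt_e; apply: eq_rk; rewrite /rk e2 ltn_add2l.
  have := ltn_ord e'.1; move: lt_e; clear; lia.
move/eqP: ne0; apply; apply/le_anti/andP; split.
  exact: (noncrossing_flow_le gS ncT).
apply: (noncrossing_flow_le gT ncS) => // e'; first by move/eq_before.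
by move=> e2 /(eq_after _ e2).
Qed.

(** * Dimension and facets of the simplices *)

Lemma acyclic_dual S e : is_graph S -> graph_acyclic S -> e \in S ->
  exists f : 'I_n.+1 -> R,
    forall e', e' \in S -> f e'.1 - f e'.2 = (e' == e)%:R.
Proof.
(* The indicator of the component of [e.1] after deleting [e] drops by one along [e] and is constant
   along the other edges. *)
move=> gS aS eS; exists (fun u => (connect (adj (S :\ e)) e.1 u)%:R) => e' e'S.
have [->|e'e] := eqVneq e' e.
  by rewrite connect0 (negbTE (acyclic_bridge gS aS eS)) subr0.
rewrite (@same_connect_r _ _ (@connect_adj_sym _ _) e'.1 e'.2) ?subrr //.
by apply: connect1; rewrite /adj -surjective_pairing !inE e'e e'S.
Qed.

(** The dual functionals make the edge vectors independent, hence affinely independent together with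
    the origin. More points are impossible because the rows [(1, x)] factor through dimension
    [1 + #|A|]. *)
Lemma root_simplex_affine_dim A :
  (forall e, e \in A -> exists f : 'I_n.+1 -> R,
     forall e', e' \in A -> f e'.1 - f e'.2 = (e' == e)%:R) ->
  affine_dim (root_simplex A) #|A|.
Proof.
move=> dualA; split.
  pose M : 'M[R]_(#|A|.+1, n.+1) := \matrix_i
    (if unlift ord0 i is Some k then root_vec R (enum_val k) else 0).
  have rowM0 : row ord0 M = 0 by rewrite rowK unlift_none.
  have rowM k : row (lift ord0 k) M = root_vec R (enum_val k) by rewrite rowK liftK.
  exists M; split.
    move=> i; case: (unliftP ord0 i) => [k|] ->; rewrite ?rowM ?rowM0.
      exists (fun e => (e == enum_val k)%:R); split => [e||].
      + exact: ler0n.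
      + rewrite (bigD1 (enum_val k)) ?enum_valP //= eqxx big1 ?addr0 //.
        by move=> e /andP[_ /negbTE->].
      + rewrite (bigD1 (enum_val k)) ?enum_valP //= eqxx scale1r big1 ?addr0 //.
        by move=> e /andP[_ /negbTE->]; rewrite scale0r.
    exists (fun _ => 0); split => //; first by rewrite big1.
    by rewrite big1 // => e _; rewrite scale0r.
  apply: inj_row_free => v; rewrite mul_mx_row => /eqP.
  rewrite row_mx_eq0 => /andP[/eqP v1 /eqP vM].
  have vE : \sum_k v 0 (lift ord0 k) *: root_vec R (enum_val k) = 0.
    rewrite -[RHS]vM mulmx_sum_row big_ord_recl rowM0 scaler0 add0r.
    by apply: eq_bigr => k _; rewrite rowM.
  have vl k : v 0 (lift ord0 k) = 0.
    have [f fP] := dualA _ (enum_valP k).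
    have /(congr1 (fun x => (x *m \col_u f u) 0 0)) /= := vE.
    rewrite mul0mx => /esym; rewrite mxE mulmx_suml summxE (bigD1 k) //= big1 ?addr0.
      by rewrite -scalemxAl mxE mulmx_root_vec fP ?enum_valP // eqxx mulr1.
    move=> k' k'k; rewrite -scalemxAl mxE mulmx_root_vec fP ?enum_valP //.
    by rewrite (inj_eq enum_val_inj) (negbTE k'k) mulr0.
  apply/rowP => i; rewrite mxE; case: (unliftP ord0 i) => [k|] ->; first exact: vl.
  have /(congr1 (fun x : 'M[R]_1 => x 0 0)) /= := v1.
  rewrite !mxE big_ord_recl big1 ?addr0; last by move=> k _; rewrite vl mul0r.
  by rewrite mxE mulr1.
case=> M [MA]; apply/negP; rewrite -row_leq_rank -ltnNge ltnS.
have cM i : exists c, row i M = \sum_(e in A) c e *: root_vec R e.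
  by have [c [_ _ xE]] := MA i; exists c.
have {cM} [c cM] := boolp.choice cM.
pose B : 'M[R]_(#|A|, n.+1) := \matrix_k root_vec R (enum_val k).
pose W : 'M[R]_(#|A|.+2, #|A|) := \matrix_(i, k) c i (enum_val k).
have MWB : M = W *m B.
  apply/row_matrixP => i; rewrite cM row_mul mulmx_sum_row big_enum_val /=.
  by apply: eq_bigr => k _; rewrite rowK !mxE.
pose C1 : 'cV[R]_(#|A|.+2) := const_mx 1.
have -> : row_mx (const_mx 1) M = row_mx C1 W *m block_mx 1%:M 0 0 B.
  by rewrite mul_row_block mulmx1 !mulmx0 addr0 add0r MWB.
by apply: leq_trans (mulmx_max_rank _ _) _; rewrite add1n.
Qed.

Lemma root_simplex_facet S e : is_graph S -> graph_acyclic S -> e \in S ->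
  is_facet (root_simplex S) (root_simplex (S :\ e)).
Proof.
move=> gS aS eS; split; last first.
  exists #|S :\ e|; split.
    have -> : #|S :\ e|.+1 = #|S| by rewrite (cardsD1 e S) eS.
    by apply: root_simplex_affine_dim => e' /(acyclic_dual gS aS).
  apply: root_simplex_affine_dim => e' /setD1P[_ /(acyclic_dual gS aS)[f fP]].
  by exists f => e'' /setD1P[_ /fP].
have [f fP] := acyclic_dual gS aS eS.
(* The negated dual functional takes the value [- c e], so its maximum 0 is attained exactly where
   the coefficient of [e] vanishes. *)
exists (\col_u - f u), 0.
have fE c : ((\sum_(e in S) c e *: root_vec R e) *m \col_u - f u) 0 0 = - c e.
  have fN e' : e' \in S -> - f e'.1 - - f e'.2 = - (e' == e)%:R.
    by move=> /fP <-; rewrite opprB opprK addrC.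
  rewrite mulmx_sum_root_vec (bigD1 e) //= big1 ?addr0 => [|e' /andP[e'S /negbTE e'e]].
    by rewrite fN // eqxx mulrN1.
  by rewrite fN // e'e oppr0 mulr0.
split; first by move=> x [c [c0 _ ->]]; rewrite fE oppr_le0.
have sS : S :\ e \subset S by apply: finset.subD1set.
apply/seteqP; split => x /=.
  move/(root_simplexP _ sS) => [c [c0 cS c1 ->]].
  by rewrite fE cS ?setD11 ?oppr0 //; split => //; exists c.
case=> -[c [c0 c1 ->]]; rewrite fE => /eqP; rewrite oppr_eq0 => /eqP ce.
exists c; split => //.
  by move: c1; rewrite (big_setD1 e) //= ce add0r.
by rewrite (big_setD1 e) //= ce scale0r add0r.
Qed.

End Geometry.

(** * The lexicographic shelling *)

Theorem theorem28 (R : realType) (n : nat) (hn : (1 <= n)%N)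
  (T : graph n) (hT : is_tree T) (hTnc : noncrossing T)
  (k : nat) (Ts : 'I_k -> graph n)
  (hTs : forall S : graph n,
     (exists i : 'I_k, Ts i = S) <->
     [/\ spanning_tree_of (tclosure T) S, noncrossing S & alternating S])
  (hlex : forall i j : 'I_k, (i < j)%N -> lex_lt (Ts i) (Ts j)) :
  is_shelling (fun i : 'I_k => root_polytope R (Ts i)).
Proof.
have TsP i : [/\ spanning_tree_of (tclosure T) (Ts i), noncrossing (Ts i) &
    alternating (Ts i)] by apply/hTs; exists i.
have gTs i : is_graph (Ts i) by have [[[]]] := TsP i.
have aTs i : graph_acyclic (Ts i) by have [[[]]] := TsP i.
have ncTs i : noncrossing (Ts i) by have [] := TsP i.
have altTs i : alternating (Ts i) by have [] := TsP i.
have PE i : root_polytope R (Ts i) = root_simplex (Ts i) by apply: root_polytopeE.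
have flip (i j : 'I_k) : j < i -> exists e, [/\ e \in Ts i, e \notin Ts j &
    exists2 j' : 'I_k, j' < i & Ts i :\ e \subset Ts j'].
  move=> ji; have [f [fj fi f_min]] := lex_lt_first_diff (hlex _ _ ji).
  have [gT _ _] := hT; have [tree_i _ _] := TsP i; have [[_ sjT] _ _] := TsP j.
  have [e [g [ei ej gi lt_ge /hTs[j' j'E]]]] := lex_decreasing_flip gT hTnc tree_i
    (ncTs i) (altTs i) sjT (ncTs j) (altTs j) fj fi f_min.
  exists e; split => //; exists j'; last by rewrite j'E finset.subsetUr.
  (* If [i < j'], the first difference is an edge of [Ts i] missing from [Ts j'], which can only be
     [e]. But then [g], smaller than [e] and in [Ts j'], would be in [Ts i]. *)
  case: (ltngtP j' i) => // [ij'|/val_inj j'i]; last first.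
    by move: gi; rewrite -j'i j'E setU11.
  have [h [hi hj' h_min]] := lex_lt_first_diff (hlex _ _ ij').
  have he : h = e.
    by apply/eqP; apply: contraNT hj' => he; rewrite j'E !inE he hi orbT.
  by move: gi; rewrite h_min ?he // j'E setU11.
move=> i i_gt0.
exists [set F | exists e, [/\ e \in Ts i,
    exists2 j : 'I_k, j < i & Ts i :\ e \subset Ts j &
    F = root_simplex (Ts i :\ e)]]%classic; split.
(* Comparison with the simplex of index 0 supplies at least one facet. *)
- have k_gt0 : 0 < k by apply: leq_ltn_trans (ltn_ord i).
  have [|e [ei _ je]] := flip i (Ordinal k_gt0); first exact: i_gt0.
  by exists (root_simplex (Ts i :\ e)), e.
- by move=> F [e [ei _ ->]]; rewrite PE; apply: root_simplex_facet.
apply/seteqP; split => x.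
  case; rewrite PE => xi [j /= ji]; rewrite PE => xj.
  have [e [ei ej je]] := flip i j ji.
  exists (root_simplex (Ts i :\ e)); first by exists e.
  have [c [c0 ci c1 xc]] := (root_simplexP _ (finset.subsetT (Ts i))).1 xi.
  have [d [d0 dj d1 xd]] := (root_simplexP _ (finset.subsetT (Ts j))).1 xj.
  (* Both families represent [x], so they agree, and [c e = d e = 0] because [e] is not in
     [Ts j]. *)
  have cd : c =1 d.
    apply: (@noncrossing_alternating_unique R n (Ts i) (Ts j)) => //.
    move: xd; rewrite xc; under eq_bigl do rewrite inE.
    by under [RHS]eq_bigl do rewrite inE.
  apply/(root_simplexP _ (finset.subsetT _)); exists c; split => // e'.
  rewrite !inE negb_and negbK => /orP[/eqP->|/ci //].
  by rewrite cd dj.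
case=> F [e [ei [j ji sij] ->]] xF; split.
  rewrite PE; have sub := finset.subD1set (Ts i) e.
  by have [c [c0 _ c1 xc]] := (root_simplexP _ sub).1 xF; exists c.
exists j => //=; rewrite PE.
by have [c [c0 _ c1 xc]] := (root_simplexP _ sij).1 xF; exists c.
Qed.
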